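(* Let $n$ and $q$ be positive integers, and let $\pi$ be a uniformly random permutation of $\{1,\ldots,n\}$. Read the cycles of $\pi$ in canonical order. Then the following rule gives the exact law of the outcome of the $q$-game started from a pile of $n$ elements. The random player wins if and only if $\pi$ has a cycle of length at most $q$ and the first such cycle in canonical order is a fixed point (has length $1$). The deterministic player wins if and only if either $\pi$ has a cycle of length at most $q$ and the first such cycle in canonical order has length in $\{2,\ldots,q\}$, or $\pi$ has no cycle of length at most $q$. That is, writing $R_n^{(q)}$ and $D_n^{(q)}$ for the probabilities that the random player and the deterministic player, respectively, win the $q$-game from $n$ elements, $$R_n^{(q)}=\mathbb{P}\bigl(\pi \text{ has a cycle of length at most } q \text{ and the first such cycle in canonical order has length } 1\bigr),$$ $$D_n^{(q)}=\mathbb{P}\bigl(\pi \text{ has a cycle of length at most } q \text{ and the first such cycle in canonical order has length in } \{2,\ldots,q\},\ \text{or } \pi \text{ has no cycle of length at most } q\bigr).$$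
   Context: The $q$-game: fix a positive integer $q$. The game starts with a pile of $n$ elements. Two players, the random player and the deterministic player, move alternately, and the random player moves first. If there are $m$ elements at the start of the random player's turn, the random player removes $k$ elements, where $k$ is chosen uniformly from $\{1,\ldots,m\}$ (independently of the past given $m$). If this empties the pile, the random player wins. Otherwise, the deterministic player removes $\min(q,m')$ elements, where $m'$ is the number of elements remaining after the random player's move. If this empties the pile, the deterministic player wins. Otherwise the game continues with the random player's turn. Canonical order of cycles: the cycles of a permutation of $\{1,\ldots,n\}$ (fixed points count as cycles of length $1$) are listed as follows: first the cycle containing the smallest element, then the cycle containing the smallest element not yet written, and so on. Equivalently, cycles are listed in increasing order of their smallest elements. *)

(* Defs.v *)
From HB Require Import structures.
From mathcomp Require Import all_boot all_order all_algebra all_fingroup.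
From mathcomp Require Import zify.

Set Implicit Arguments.
Unset Strict Implicit.
Unset Printing Implicit Defensive.

Import Order.TTheory GRing.Theory Num.Theory.

Local Open Scope nat_scope.

Variant player := RandomPlayer | DeterministicPlayer.

Definition is_random (p : player) : bool :=
  if p is RandomPlayer then true else false.

Definition player_of_bool (b : bool) : player :=
  if b then RandomPlayer else DeterministicPlayer.

Fact is_randomK : cancel is_random player_of_bool. Proof. by case. Qed.

HB.instance Definition _ := Equality.copy player (can_type is_randomK).

(** The pile left for the random player's next turn, when the random player
    removes [k] out of [m] elements and the deterministic player answers. *)
Definition next_pile (q m k : nat) : nat := (m - k) - minn q (m - k).

(** A play is recorded by the sequence [ks] of the successive removals of the
    random player, the other moves being forced. [outcome q m ks] is [Some w]
    if [ks] is the record of a complete play from a pile of [m] elements which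
    is won by [w], and [None] if [ks] is not the record of a complete play
    (a move is illegal, the game is not over after [ks], or [ks] goes on after
    the end of the game). *)
Fixpoint outcome (q m : nat) (ks : seq nat) : option player :=
  if ks is k :: ks' then
    if ~~ (1 <= k <= m) then None
    else if m - k == 0 then
      if nilp ks' then Some RandomPlayer else None
    else if next_pile q m k == 0 then
      if nilp ks' then Some DeterministicPlayer else None
    else outcome q (next_pile q m k) ks'
  else None.

(** Probability of a play: each removal is uniform among the [m] possible ones,
    where [m] is the current pile, independently of the past given [m]. *)
Fixpoint play_prob (q m : nat) (ks : seq nat) : rat :=
  if ks is k :: ks' then (m%:R^-1 * play_prob q (next_pile q m k) ks')%R
  else 1%R.

(** Each removal of the random player is at least [1] and at most [n], so the
    complete plays from [n] elements are among the sequences of length at most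
    [n] with entries at most [n]. *)
Definition win_prob (q n : nat) (w : player) : rat :=
  (\sum_(r < n.+1) \sum_(ks : r.-tuple 'I_n.+1
        | outcome q n (map val ks) == Some w)
     play_prob q n (map val ks))%R.

(** [outcome_bounded] and [win_prob_total]: [win_prob] misses no complete play and
    [play_prob] is a probability on complete plays. *)
Lemma outcome_bounded (q m : nat) (ks : seq nat) (w : player) :
  outcome q m ks = Some w -> (size ks <= m) && all (fun k => k <= m) ks.
Proof.
elim: ks m => [|k ks IH] m //=.
case: ifP => // /negbFE /andP[k1 km].
have small : nilp ks -> (size ks < m) && ((k <= m) && all (leq^~ m) ks).
  by move=> /nilP ->; rewrite /= km (leq_trans k1 km).
case: ifP => _; first by case: ifP => // /small.
case: ifP => _; first by case: ifP => // /small.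
move/IH => /andP[sz al].
have lt : next_pile q m k < m.
  rewrite /next_pile; apply: leq_ltn_trans (leq_subr _ _) _.
  by rewrite ltn_subrL k1 (leq_trans k1 km).
rewrite (leq_ltn_trans sz lt) km /=.
by apply: sub_all al => x /leq_trans; apply; apply: ltnW.
Qed.

Lemma next_pile_lt (q m k : nat) : 0 < k <= m -> next_pile q m k < m.
Proof.
case/andP=> k1 km; rewrite /next_pile; apply: leq_ltn_trans (leq_subr _ _) _.
by rewrite ltn_subrL k1 (leq_trans k1 km).
Qed.

Lemma play_prob_total (q N L m : nat) : 0 < m -> m <= N -> m <= L ->
  (\sum_(r < L.+1) \sum_(ks : r.-tuple 'I_N.+1
        | outcome q m (map val ks) != None)
     play_prob q m (map val ks) = 1)%R.
Proof.
elim: L m => [|L IH] m m0 mN mL; first by rewrite leqNgt m0 in mL.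
rewrite big_ord_recl big1 ?add0r; last by move=> ks; rewrite tuple0.
pose T k r := (\sum_(ks : r.-tuple 'I_N.+1
  | outcome q m (k :: map val ks) != None)
  m%:R^-1 * play_prob q (next_pile q m k) (map val ks))%R : rat.
transitivity (\sum_(k < N.+1) \sum_(r < L.+1) T k r)%R.
  rewrite exchange_big; apply: eq_bigr => r _ /=.
  rewrite /T pair_big_dep /=.
  rewrite (reindex_onto (fun p : 'I_N.+1 * r.-tuple 'I_N.+1 =>
      [tuple of p.1 :: p.2]) (fun t => (thead t, [tuple of behead t]))) /=.
    apply: eq_bigl => -[k ks] /=; rewrite [X in _ && X](_ : _ = true) ?andbT //.
    by apply/eqP; congr pair => //; apply: val_inj.
  by move=> t _; rewrite -tuple_eta.
have inner (k : 'I_N.+1) :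
    (\sum_(r < L.+1) T k r = if (0 < k <= m)%N then m%:R^-1 else 0)%R.
  case: ifPn => km; last first.
    by rewrite big1 // => r _; rewrite /T big1 // => ks /=; rewrite km.
  have [/orP dead|] := boolP ((m - k == 0) || (next_pile q m k == 0)).
    rewrite big_ord_recl /T /= [X in (_ + X)%R]big1 ?addr0 => [|r _]; last first.
      rewrite big1 // => ks; rewrite km /=.
      by case: (ks) => -[|? ?] //= _; case: dead => -> //; case: ifP.
    rewrite (big_pred1 [tuple]) ?mulr1 //= => ks; rewrite tuple0 /= km /=.
    by rewrite eqxx; case: dead => -> //; case: ifP.
  rewrite negb_or => /andP[/negPf mk /negPf nk].
  under eq_bigr => r _ do rewrite /T /= km mk nk /= -big_distrr /=.
  rewrite -big_distrr /= IH ?mulr1 //; first by rewrite lt0n nk.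
    by rewrite (leq_trans (ltnW (next_pile_lt q km))).
  by rewrite -ltnS (leq_trans (next_pile_lt q km)).
under eq_bigr => k _ do rewrite inner.
rewrite -big_mkcond /= sumr_const.
have -> : #|[pred k : 'I_N.+1 | 0 < k <= m]| = m.
  rewrite -sum1_card -(big_mkord (fun k => 0 < k <= m) (fun=> 1)).
  rewrite (big_cat_nat (n := m.+1)) //= [X in _ + X]big_nat_cond.
  rewrite [X in _ + X]big_pred0; last by move=> i; case: (ltngtP m i); lia.
  rewrite big_ltn_cond //= addn0 big_nat_cond.
  rewrite (eq_bigl (fun i => (0 < i < m.+1) && true)); last by move=> i /=; lia.
  by rewrite -big_nat_cond sum_nat_const_nat muln1 subn1.
by rewrite -[LHS]mulr_natr mulVf // pnatr_eq0 -lt0n.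
Qed.

Lemma win_prob_total (q n : nat) : 0 < n ->
  (win_prob q n RandomPlayer + win_prob q n DeterministicPlayer = 1)%R.
Proof.
move=> n0; rewrite -[RHS](play_prob_total q n0 (leqnn n) (leqnn n)).
rewrite /win_prob -big_split /=; apply: eq_bigr => r _.
rewrite [RHS](bigID (fun ks : r.-tuple 'I_n.+1 =>
  outcome q n (map val ks) == Some RandomPlayer)) /=.
by congr (_ + _)%R; apply: eq_bigl => ks; case: outcome => [[]|].
Qed.

Definition unif_prob (T : finType) (E : pred T) : rat :=
  (#|[set x | E x]|%:R / #|T|%:R)%R.

(** The default value [n] is never reached on a nonempty [C]. *)
Definition smallest_elt (n : nat) (C : {set 'I_n}) : nat :=
  \big[minn/n]_(i in C) val i.

(** The blocks of [porbits s] are the supports of the cycles of [s], fixed points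
    included, so that the length of a cycle is the cardinal of its block. *)
Definition canonical_cycles (n : nat) (s : 'S_n) : seq {set 'I_n} :=
  sort (fun C C' => smallest_elt C <= smallest_elt C') (enum (porbits s)).

Definition short_cycles (q n : nat) (s : 'S_n) : seq {set 'I_n} :=
  [seq C : {set 'I_n} <- canonical_cycles s | #|C| <= q].

Definition has_short_cycle (q n : nat) (s : 'S_n) : bool :=
  [exists C in porbits s, #|C| <= q].

(** Junk value [0] unless [has_short_cycle q s]. *)
Definition first_short_length (q n : nat) (s : 'S_n) : nat :=
  #|head set0 (short_cycles q s)|.

(* Main.v *)
Require Import Defs.
From mathcomp Require Import all_boot all_order all_algebra all_fingroup.
From mathcomp Require Import zify ring.

(** In the game, a first removal of [k = m] wins for the random player, and any
    other [k] leaves [m - k - q] elements, or ends the game in favour of the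
    deterministic player when this truncated difference is [0].  Setting
    [R_0 = 0], the winning probabilities of the random player therefore satisfy
    [R_m = (1 + \sum_(j < m - q) R_j) / m] for [m > 0].

    On the side of permutations, call [x] the least element of a set of size
    [m].  The length [l] of the cycle of [x] is uniform on [1 .. m], and given
    the support [C] of this cycle, what the permutation does outside [C] is a
    uniform permutation of the complement.  Since the cycle of [x] is the first
    in canonical order, either [l = 1] and the event holds, or [1 < l <= q] and
    it fails, or [l > q] and everything is decided by the [m - l] remaining
    elements.  Hence the probability of the event satisfies
    [P_m = (1 + \sum_(q < l <= m) P_(m - l)) / m], which is the same recurrence.

    To make the second recurrence an honest induction, permutations of subsets
    [X] of a fixed ['I_n] are used ([perm_on X]), and the event is rephrased
    without sorting cycles: the first short cycle is a fixed point [i] exactly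
    when [i] is fixed and all smaller elements lie in long cycles
    ([fixed_point_firstE]).  The recurrences are [random_win_within_rec] and
    [fixed_point_first_prob_rec]; the latter rests on the factorization
    [card_perm_porbit_eq] and on the count [card_full_cycles].  The assertion on
    the deterministic player follows by complementation, every nonempty pile
    having exactly one winner with total probability [1]. *)

Set Implicit Arguments.
Unset Strict Implicit.
Unset Printing Implicit Defensive.

Import Order.TTheory GRing.Theory Num.Theory.

Local Open Scope nat_scope.

(** * Splitting a permutation along the cycle of a point *)

Section CycleDecomposition.
Variable T : finType.
Implicit Types (s t c : {perm T}) (X C D : {set T}) (x y : T).

Lemma eq_in_porbit D s t x :
    {in D, forall y, s y \in D} -> {in D, s =1 t} -> x \in D ->
  porbit s x = porbit t x.
Proof.
move=> sD st xD; apply/porbit_setP => y.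
have E i : ((s ^+ i)%g x \in D) && ((s ^+ i)%g x == (t ^+ i)%g x).
  elim: i => [|i /andP[iD /eqP iE]]; first by rewrite !expg0 !perm1 xD /=.
  by rewrite !expgSr !permM -iE sD //= st.
apply/porbitP/porbitP => -[i ->]; exists i.
  by case/andP: (E i) => _ /eqP.
by case/andP: (E i) => _ /eqP.
Qed.

Lemma perm_in_porbit s x y : (s y \in porbit s x) = (y \in porbit s x).
Proof. by rewrite -!eq_porbit_mem -[s y]/((s ^+ 1)%g y) porbit_perm. Qed.

Lemma porbit_sub_perm_on X s x : perm_on X s -> x \in X -> porbit s x \subset X.
Proof.
move=> sX xX; apply/subsetP => _ /porbitP[i ->].
by elim: i => [|i IH]; rewrite ?perm1 // expgSr permM (perm_closed _ sX).
Qed.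

Definition full_cycles C x := [set c | perm_on C c && (porbit c x == C)].

(** Fixing the support [C] of the cycle of [x] splits a permutation of [X] into
    two independent parts, a cycle on [C] and a permutation of [X :\: C]; the
    bijection is multiplication of permutations with disjoint supports. *)
Lemma card_perm_porbit_eq X C x (H : pred {perm T}) :
    C \subset X -> x \in C ->
    (forall s t, perm_on (X :\: C) t -> {in X :\: C, s =1 t} -> H s = H t) ->
  #|[set s | [&& perm_on X s, porbit s x == C & H s]]| =
    #|full_cycles C x| * #|[set t | perm_on (X :\: C) t && H t]|.
Proof.
move=> CX xC Hext; rewrite -cardsX.
have mul_on_C c t : perm_on C c -> perm_on (X :\: C) t -> {in C, (c * t)%g =1 c}.
  move=> cC tD y yC; rewrite permM (out_perm tD) // inE.
  by rewrite (perm_closed _ cC) yC.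
have mul_on_D c t : perm_on C c -> perm_on (X :\: C) t ->
    {in X :\: C, (c * t)%g =1 t}.
  by move=> cC tD y /setDP[_ yC]; rewrite permM (out_perm cC).
rewrite -(@card_in_imset _ _ (fun p => (p.1 * p.2)%g)); last first.
  move=> [c t] [c' t'] /[!inE] /= /andP[/andP[cC _] /andP[tD _]].
  case/andP=> /andP[c'C _] /andP[t'D _] eq_ct.
  suff eq_c : c = c' by move: eq_ct; rewrite eq_c => /mulgI ->.
  apply/permP => y; have [yC|yC] := boolP (y \in C).
    by rewrite -(mul_on_C c t) // eq_ct mul_on_C.
  by rewrite !(out_perm _ yC).
apply: eq_card => s; apply/idP/imsetP => [|[[c t]]]; rewrite !inE /=.
  case/and3P=> sX /eqP orbC Hs.
  have stabC : (s \in 'N(C | 'P))%g.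
    by apply/astabsP => y; rewrite /= apermE -orbC perm_in_porbit.
  (* The factors of [s] are its restriction to [C] and what remains of [s] once
     this restriction is undone. *)
  set c := restr_perm C s; have cC : perm_on C c by apply: restr_perm_on.
  have cE : {in C, c =1 s} by move=> y yC; rewrite restr_permE.
  have VC y : y \in C -> (c^-1)%g y \in C.
    by rewrite (perm_closed _ (perm_onV cC)).
  have tD : perm_on (X :\: C) (c^-1 * s)%g.
    apply/subsetP => y; apply: contraR; rewrite inE negb_and negbK permM.
    have [yC _|yC /= yX] := boolP (y \in C); first by rewrite -cE ?VC ?permKV.
    by rewrite (out_perm (perm_onV cC)) ?(out_perm sX).
  exists (c, c^-1 * s)%g; last by rewrite /= mulKVg.
  rewrite !inE /= cC tD /= -[X in _ == X]orbC.
  rewrite (@eq_in_porbit C c s) ?eqxx //=; last first.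
    by move=> y yC; rewrite (perm_closed _ cC).
  by rewrite -(Hext s) // => y yD; rewrite -[in LHS](mulKVg c s) mul_on_D.
case/andP=> /andP[cC /eqP orbC] /andP[tD Ht] ->.
rewrite (Hext _ t) ?Ht ?andbT //; last exact: mul_on_D.
rewrite -[X in _ == X]orbC -(@eq_in_porbit C c (c * t)%g) ?eqxx ?andbT //.
- apply: perm_onM; first exact: subset_trans cC CX.
  exact: subset_trans tD (subsetDl _ _).
- by move=> y yC; rewrite (perm_closed _ cC).
- by move=> y yC; rewrite mul_on_C.
Qed.

(** A set of size [l.+1] between [[set x]] and [X] is [x] together with [l] of
    the other elements of [X]. *)
Lemma sum_sets_by_card (R : nmodType) X x (F : nat -> R) : x \in X ->
  (\sum_(C : {set T} | (x \in C) && (C \subset X)) F #|C| =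
   \sum_(l < #|X|) F l.+1 *+ 'C(#|X|.-1, l))%R.
Proof.
move=> xX; have cX : #|X :\ x| = #|X|.-1 by rewrite [in RHS](cardsD1 x) xX.
have X0 : #|X| = #|X|.-1.+1 by rewrite prednK // (cardD1 x) xX.
rewrite (reindex_onto (fun B => x |: B) (fun C => C :\ x)); last first.
  by move=> C /andP[xC _]; rewrite setD1K.
have -> : (\sum_(B : {set T} | (x \in x |: B) && (x |: B \subset X) &&
    ((x |: B) :\ x == B)) F #|x |: B| =
    \sum_(B : {set T} | B \subset X :\ x) F #|B|.+1)%R.
  apply: eq_big => B.
    rewrite setU11 subUset sub1set xX /= subsetD1; congr (_ && _).
    apply/eqP/idP => [/setP/(_ x)|xB]; first by rewrite !inE eqxx => <-.
    by rewrite setU1K.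
  by case/andP=> _ /eqP/setP/(_ x); rewrite cardsU1 !inE eqxx => <-.
move: #|X|.-1 cX X0 => m cX ->.
rewrite (partition_big (fun B : {set T} => inord #|B| : 'I_m.+1) predT) //=.
apply: eq_bigr => l _.
have -> : 'C(m, l) = #|[set A : {set T} | A \subset X :\ x & #|A| == l]|.
  by rewrite cards_draws cX.
rewrite -sumr_const.
have lt (B : {set T}) : B \subset X :\ x -> #|B| < m.+1.
  by move=> BX; rewrite ltnS -cX subset_leq_card.
apply: eq_big => [B|B /andP[/lt ltB /eqP<-]]; last by rewrite inordK.
rewrite inE; apply: andb_id2l => /lt ltB.
by rewrite -val_eqE /= inordK.
Qed.

(** The event [H] may depend on the cycle [C] of [x] and on the values outside
    [C]; this is the form in which the rest of the permutation can be treated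
    as a permutation of a smaller set. *)
Lemma card_perm_by_first_cycle X x (H : {set T} -> pred {perm T}) : x \in X ->
    (forall C s t, C \subset X -> perm_on (X :\: C) t ->
       {in X :\: C, s =1 t} -> H C s = H C t) ->
  #|[set s | perm_on X s && H (porbit s x) s]| =
  \sum_(C : {set T} | (x \in C) && (C \subset X))
     #|full_cycles C x| * #|[set t | perm_on (X :\: C) t && H C t]|.
Proof.
move=> xX Hext; rewrite -sum1_card.
rewrite (partition_big (fun s => porbit s x)
   (fun C : {set T} => (x \in C) && (C \subset X))) /=; last first.
  by move=> s; rewrite inE porbit_id => /andP[/porbit_sub_perm_on-> //].
apply: eq_bigr => C /andP[xC CX]; rewrite -card_perm_porbit_eq //; last first.
  by move=> s t; apply: Hext.
rewrite -sum1_card; apply: eq_bigl => s; rewrite !inE -andbA.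
by case: eqP => [->|_]; rewrite ?andbT ?andbF.
Qed.

(** No cycle has to be written down: by [card_perm_by_first_cycle] with the
    trivial event, [#|C|`!] is the sum of the terms of all possible supports
    [D] of the cycle of [x].  By induction each [D != C] of size [l] contributes
    [(l - 1)! * (#|C| - l)!], and there are ['C(#|C| - 1, l - 1)] of them, so each
    length [l < #|C|] accounts for [(#|C| - 1)!] permutations; what is left for
    [D = C] is [(#|C| - 1)!] as well. *)
Lemma card_full_cycles C x : x \in C -> #|full_cycles C x| = (#|C|.-1)`!.
Proof.
have [m] := ubnP #|C|; elim: m C => // m IH C; rewrite ltnS => leCm xC.
have C0 : #|C| = #|C|.-1.+1 by rewrite prednK // (cardD1 x) xC.
have := @card_perm_by_first_cycle C x (fun _ _ => true) xC (fun _ _ _ _ _ _ => erefl).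
have -> : #|[set s | perm_on C s && true]| = #|C|`!.
  by rewrite -card_perm; apply: eq_card => s; rewrite !inE andbT.
rewrite (bigD1 C) ?xC ?subxx //= setDv.
have -> : #|[set t : {perm T} | perm_on set0 t && true]| = 1.
  rewrite -[RHS]/(0`!) -[in RHS](@cards0 T) -card_perm.
  by apply: eq_card => s; rewrite !inE andbT.
rewrite muln1.
have -> : \sum_(D : {set T} | (x \in D) && (D \subset C) && (D != C))
    #|full_cycles D x| * #|[set t : {perm T} | perm_on (C :\: D) t && true]| =
    #|C|.-1 * #|C|.-1`!.
  pose F l := if l == #|C| then 0 else l.-1`! * (#|C| - l)`!.
  transitivity (\sum_(D : {set T} | (x \in D) && (D \subset C)) F #|D|).
    rewrite [RHS](bigD1 C) ?xC ?subxx //= /F eqxx add0n.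
    apply: eq_bigr => D /andP[/andP[xD DC] neqDC].
    have ltDC : #|D| < #|C| by rewrite proper_card // properEneq neqDC.
    rewrite ltn_eqF // IH ?(leq_trans ltDC) //; congr (_ * _).
    rewrite -[in RHS](setIidPr DC) -cardsD -card_perm.
    by apply: eq_card => s; rewrite !inE andbT.
  rewrite (sum_sets_by_card F xC).
  rewrite {}/F; move: #|C|.-1 C0 => k -> /=.
  rewrite big_ord_recr /= eqxx mul0rn addr0.
  transitivity (\sum_(l < k) k`!); last by rewrite sum_nat_const card_ord.
  apply: eq_bigr => l _; have lk := ltn_ord l.
  by rewrite eqSS ltn_eqF // subSS -(bin_fact (ltnW lk)) -mulr_natl natn.
rewrite [in X in X = _]C0 factS mulSn; lia.
Qed.

End CycleDecomposition.

(** * A fixed point as first short cycle *)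

(** The event that the first cycle of length at most [q] is a fixed point, for
    a permutation of [X], in a form which needs no ordering of the cycles and
    restricts well to complements of cycles. *)
Definition fixed_point_first q n (X : {set 'I_n}) (s : 'S_n) : bool :=
  [exists i in X, (s i == i) && [forall (j | (j \in X) && (j < i)), q < #|porbit s j|]].

Lemma card_porbit_eq1 (T : finType) (s : {perm T}) x :
  (#|porbit s x| == 1) = (s x == x).
Proof.
apply/cards1P/eqP => [[y orb]|fix_x].
  have := porbit_id s x; have := mem_porbit s 1 x.
  by rewrite expg1 orb => /set1P -> /set1P ->.
exists x; apply/setP => y; rewrite inE; apply/idP/eqP => [|->]; last exact: porbit_id.
case/porbitP=> i ->; elim: i => [|i IH]; first by rewrite perm1.
by rewrite expgSr permM IH.
Qed.

Lemma eq_fixed_point_first q n (D : {set 'I_n}) (s t : 'S_n) :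
  perm_on D t -> {in D, s =1 t} ->
  fixed_point_first q D s = fixed_point_first q D t.
Proof.
move=> tD st.
have orb j : j \in D -> porbit s j = porbit t j.
  by apply: eq_in_porbit => // y yD; rewrite st // (perm_closed _ tD).
apply: eq_existsb => i; apply: andb_id2l => iD; rewrite st //; congr (_ && _).
by apply: eq_forallb => j; case jD: (j \in D); rewrite //= orb.
Qed.

(** The cycle of the least element [x] comes first in canonical order: it
    decides the event if it is short, and can be discarded if it is long. *)
Lemma fixed_point_first_rec q n (X : {set 'I_n}) (s : 'S_n) x :
  x \in X -> {in X, forall j : 'I_n, x <= j} -> perm_on X s ->
  fixed_point_first q X s =
  (#|porbit s x| == 1) ||
  (q < #|porbit s x|) && fixed_point_first q (X :\: porbit s x) s.
Proof.
move=> xX xmin sX.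
have [fx|nfx] /= := boolP (#|porbit s x| == 1).
  apply/exists_inP; exists x => //; rewrite -card_porbit_eq1 fx /=.
  apply/forall_inP => j /andP[jX]; rewrite ltnNge xmin //.
have orbC j : j \in porbit s x -> porbit s j = porbit s x.
  by move=> jC; apply/eqP; rewrite eq_porbit_mem.
apply/exists_inP/andP => [[i iX /andP[si /forall_inP first_i]]|[long]].
  have ix : i != x by apply: contra nfx => /eqP <-; rewrite card_porbit_eq1.
  have xi : x < i by rewrite ltn_neqAle xmin // andbT eq_sym val_eqE.
  split; first by apply: first_i; rewrite xX.
  apply/exists_inP; exists i; last rewrite si /=.
    rewrite inE iX andbT; apply: contra nfx => /orbC <-.
    by rewrite card_porbit_eq1.
  apply/forall_inP => j /andP[/setDP[jX _] ji]; apply: first_i; exact/andP.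
case/exists_inP=> i /setDP[iX _] /andP[si /forall_inP first_i].
exists i => //; rewrite si; apply/forall_inP => j /andP[jX ji].
have [/orbC -> //|jC] := boolP (j \in porbit s x).
by apply: first_i; rewrite inE jC jX.
Qed.

(** The arguments [i - q] with [i < q] are truncated to [0], where [G]
    vanishes. *)
Lemma sum_truncated_sub (R : nmodType) (G : nat -> R) q m : G 0 = 0%R ->
  (\sum_(i < m) G (i - q)%N = \sum_(j < m - q) G j)%R.
Proof.
move=> G0; elim: m => [|m IH]; first by rewrite sub0n !big_ord0.
rewrite big_ord_recr IH /=; have [qm|mq] := leqP q m.
  by rewrite subSn // big_ord_recr.
have -> : m.+1 - q = m - q by lia.
by rewrite (_ : m - q = 0) ?G0 ?addr0 //; lia.
Qed.

Definition fixed_point_first_prob q n (X : {set 'I_n}) : rat :=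
  (#|[set s | perm_on X s && fixed_point_first q X s]|%:R / #|X|`!%:R)%R.

(** Each length of the cycle of the least element has probability
    [#|X|^-1].  Length [1] yields the summand [1], lengths in [2 .. q] yield
    nothing, and a length [l > q] leaves [#|X| - l] elements; the sum runs over
    [j = #|X| - l]. *)
Lemma fixed_point_first_prob_rec q n (X : {set 'I_n}) (F : nat -> rat) :
    0 < q -> 0 < #|X| ->
    (forall Y : {set 'I_n}, Y \proper X -> fixed_point_first_prob q Y = F #|Y|) ->
  (fixed_point_first_prob q X = #|X|%:R^-1 * (1 + \sum_(j < #|X| - q) F j))%R.
Proof.
move=> q0 /card_gt0P[x0 x0X] FE.
(* [g l] is the conditional probability of the event given that the cycle of
   [x] has length [l]. *)
have [x xX xmin] := arg_minnP (P := [in X]) (fun i : 'I_n => val i) x0X.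
have X0 : #|X| = #|X|.-1.+1 by rewrite prednK // (cardD1 x) xX.
pose g l : rat := (if l == 1%N then 1 else if (q < l)%N then F (#|X| - l)%N else 0)%R.
pose H (C : {set 'I_n}) s :=
  (#|C| == 1) || (q < #|C|) && fixed_point_first q (X :\: C) s.
have count (C : {set 'I_n}) : (x \in C) && (C \subset X) ->
    (#|[set t | perm_on (X :\: C) t && H C t]|%:R =
     (#|X| - #|C|)%N`!%:R * g #|C| :> rat)%R.
  case/andP=> xC CX; have cD : #|X :\: C| = #|X| - #|C|.
    by rewrite cardsD (setIidPr CX).
  rewrite /g /H; case: eqP => [C1|nC1] /=.
    rewrite mulr1 -cD -card_perm; congr (_%:R)%R.
    by apply: eq_card => s; rewrite !inE andbT.
  case: ltnP => [qC|_] /=; last first.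
    rewrite mulr0 (_ : [set _ | _] = set0) ?cards0 //.
    by apply/setP => s; rewrite !inE andbF.
  have DX : X :\: C \proper X.
    by rewrite properEcard subsetDl cD ltn_subrL (leq_ltn_trans _ qC) // X0.
  rewrite -cD -FE // /fixed_point_first_prob mulrCA mulfV ?mulr1 //.
  by rewrite pnatr_eq0 -lt0n fact_gt0.
rewrite /fixed_point_first_prob.
have -> : [set s | perm_on X s && fixed_point_first q X s] =
          [set s | perm_on X s && H (porbit s x) s].
  apply/setP => s; rewrite !inE; apply: andb_id2l => sX.
  exact: fixed_point_first_rec.
rewrite card_perm_by_first_cycle //; last first.
  move=> C s t CX tD st; rewrite /H; congr (_ || (_ && _)).
  exact: eq_fixed_point_first.
rewrite natr_sum.
transitivity ((\sum_(C : {set 'I_n} | (x \in C) && (C \subset X))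
   ((#|C|.-1)`!%:R * (#|X| - #|C|)%N`!%:R * g #|C|)) / #|X|`!%:R : rat)%R.
  congr (_ / _)%R; apply: eq_bigr => C CxX; have /andP[xC _] := CxX.
  by rewrite card_full_cycles // natrM count // mulrA.
rewrite (sum_sets_by_card (fun l => l.-1`!%:R * (#|X| - l)%N`!%:R * g l)%R xX).
transitivity (#|X|%:R^-1 * \sum_(l < #|X|) g l.+1 : rat)%R.
  transitivity ((\sum_(l < #|X|) (#|X|.-1)`!%:R * g l.+1) / #|X|`!%:R : rat)%R.
    congr (_ / _)%R; apply: eq_bigr => l _.
    have lX : l <= #|X|.-1 by rewrite -ltnS -X0.
    rewrite -(bin_fact lX) -mulr_natl !natrM.
    by rewrite (_ : #|X| - l.+1 = #|X|.-1 - l); [rewrite /=; ring | lia].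
  rewrite -big_distrr /= mulrAC; congr (_ * _)%R.
  have f0 k : (k`!%:R != 0 :> rat)%R by rewrite pnatr_eq0 -lt0n fact_gt0.
  by rewrite [in X in (_ / X)%R]X0 factS -X0 natrM invfM mulrCA divff ?mulr1.
congr (_ * _)%R.
rewrite /g; case: #|X| X0 => // m _; rewrite big_ord_recl /=; congr (_ + _)%R.
rewrite (big_ord_widen m) /=; last by lia.
(* Reversal turns the length [l + 2] of the cycle, [l < m], into the number
   [m - l - 1] of the remaining elements. *)
rewrite [RHS]big_mkcond /= (reindex_inj rev_ord_inj) /=.
apply: eq_bigr => l _; have lm := ltn_ord l; rewrite /bump /=.
have -> : (q < (1 + (m - l.+1)).+1) = (l < m.+1 - q) by lia.
by have -> : m.+1 - (1 + (m - l.+1)).+1 = l by lia.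
Qed.

(** * The recurrence of the game *)

(** The bounds [N] on the moves and [L] on the number of rounds are kept apart
    from the pile [m], so that the pile and [L] can decrease while the type of
    moves stays the same; [win_prob] has all three equal. *)
Definition random_win_within q N L m : rat :=
  (\sum_(r < L.+1) \sum_(ks : r.-tuple 'I_N.+1
        | outcome q m (map val ks) == Some RandomPlayer)
     play_prob q m (map val ks))%R.

Lemma random_win_within0 q N L : random_win_within q N L 0 = 0%R.
Proof.
rewrite /random_win_within big1 // => r _; rewrite big1 // => ks.
by case: (map _ _) => // -[|k] ?.
Qed.

(** The value [G 0 = 0] encodes that an empty pile after the answer is a loss
    for the random player, so that the end of the game needs no separate case:
    [k < m] leads to [G (m - k - q)] in truncated arithmetic. *)
Lemma sum_moves q N m (G : nat -> rat) : m <= N -> 0 < m -> G 0 = 0%R ->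
  (\sum_(k < N.+1 | (0 < k <= m)%N)
     (if val k == m then 1 else G (next_pile q m k)) =
   1 + \sum_(j < m - q) G j)%R.
Proof.
move=> mN m0 G0.
rewrite -(big_mkord (fun k => 0 < k <= m)
  (fun k => if k == m then 1 else G (next_pile q m k))%R).
transitivity (\sum_(1 <= k < m.+1)
    (if k == m then 1 else G (next_pile q m k)))%R.
  rewrite [RHS](big_nat_widenl _ 0) // [RHS](big_nat_widen _ _ N.+1) ?ltnS //.
rewrite big_nat_recr //= eqxx addrC; congr (_ + _)%R.
rewrite -(sum_truncated_sub _ _ G0) -(big_mkord predT (fun i => G (i - q)))%N.
(* Reversing the sum replaces the removal [k] by the number [m - k] left. *)
rewrite [RHS]big_ltn // sub0n G0 add0r big_nat_rev /= big_nat [RHS]big_nat.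
apply: eq_bigr => k /andP[k0 km].
rewrite ltn_eqF /next_pile; last by lia.
by congr G; lia.
Qed.

(** Conditioning on the first removal: a play of [r.+1] rounds is a first move
    [k] followed by a play of [r] rounds from the pile [next_pile q m k]. *)
Lemma random_win_within_rec q N L m : 0 < m <= N ->
  (random_win_within q N L.+1 m =
   m%:R^-1 * (1 + \sum_(j < m - q) random_win_within q N L j))%R.
Proof.
case/andP=> m0 mN; rewrite /random_win_within big_ord_recl big1 ?add0r; last first.
  by move=> ks; rewrite tuple0.
pose T k r := (\sum_(ks : r.-tuple 'I_N.+1
  | outcome q m (k :: map val ks) == Some RandomPlayer)
  m%:R^-1 * play_prob q (next_pile q m k) (map val ks))%R : rat.
transitivity (\sum_(k < N.+1) \sum_(r < L.+1) T k r)%R.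
  rewrite exchange_big; apply: eq_bigr => r _ /=.
  rewrite /T pair_big_dep /=.
  rewrite (reindex_onto (fun p : 'I_N.+1 * r.-tuple 'I_N.+1 =>
      [tuple of p.1 :: p.2]) (fun t => (thead t, [tuple of behead t]))) /=.
    apply: eq_bigl => -[k ks] /=; rewrite [X in _ && X](_ : _ = true) ?andbT //.
    by apply/eqP; congr pair => //; apply: val_inj.
  by move=> t _; rewrite -tuple_eta.
rewrite -(@sum_moves q N m (random_win_within q N L)) ?random_win_within0 //.
rewrite [in RHS]big_mkcond big_distrr /=; apply: eq_bigr => k _.
case: ifPn => km; last first.
  by rewrite mulr0 big1 // => r _; rewrite /T big1 // => ks /=; rewrite km.
have mk0 : (m - k == 0) = (k == m :> nat) by lia.
have [km'|nkm] := eqVneq (k : nat) m.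
  rewrite mulr1 big_ord_recl /T /= [X in (_ + X)%R]big1 ?addr0 => [|r _].
    rewrite (big_pred1 [tuple]) ?mulr1 //= => ks; rewrite tuple0 /= km /=.
    by rewrite mk0 km' !eqxx.
  by rewrite big1 // => ks; rewrite km mk0 km' eqxx; case: (ks) => -[].
have [np0|npN] := eqVneq (next_pile q m k) 0.
  rewrite np0 random_win_within0 mulr0 big1 // => r _; rewrite /T big1 // => ks.
  by rewrite /= km mk0 (negPf nkm) np0 eqxx; case: nilp.
rewrite /random_win_within big_distrr /=; apply: eq_bigr => r _.
rewrite /T big_distrr /=; apply: eq_bigl => ks.
by rewrite /= km mk0 (negPf nkm) (negPf npN).
Qed.

(** Both sides satisfy the same recurrence; the number of rounds [L] serves as
    the induction parameter and bounds the size of [X]. *)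
Lemma random_win_within_eq q n L (X : {set 'I_n}) : 0 < q -> #|X| <= L ->
  random_win_within q n L #|X| = fixed_point_first_prob q X.
Proof.
move=> q0; elim: L X => [|L IH] X leXL.
  have /eqP X0 : X == set0 by rewrite -cards_eq0 -leqn0.
  rewrite X0 cards0 random_win_within0 /fixed_point_first_prob.
  rewrite (_ : [set _ | _] = set0) ?cards0 ?mul0r //.
  apply/setP => s; rewrite !inE; apply/negP => /andP[_ /exists_inP[i]].
  by rewrite inE.
have [X0|X0] := posnP #|X|.
  rewrite X0 random_win_within0 -(random_win_within0 q n L) -X0 IH //.
  by rewrite X0.
rewrite random_win_within_rec; last by rewrite X0 -[X in _ <= X]card_ord max_card.
apply/esym; apply: fixed_point_first_prob_rec => // Y /proper_card YX.
by rewrite IH // -ltnS (leq_trans YX).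
Qed.

(** * Back to cycles in canonical order *)

Lemma smallest_elt_le n (C : {set 'I_n}) i : i \in C -> smallest_elt C <= i.
Proof.
by move=> iC; exact: (@bigmin_le_cond _ nat _ n i (fun j => j \in C) val).
Qed.

Lemma smallest_elt_leP n (C : {set 'I_n}) (i : 'I_n) :
  smallest_elt C <= i -> exists2 j : 'I_n, j \in C & j <= i.
Proof.
move=> Ci; apply/exists_inP; apply: contraLR Ci => /exists_inPn big.
rewrite -ltnNge /smallest_elt; elim/big_ind: _ => [|a b ia ib|j jC] //.
  by rewrite leq_min ia.
by rewrite ltnNge; apply: big.
Qed.

Lemma mem_short_cycles q n (s : 'S_n) C :
  (C \in short_cycles q s) = (C \in porbits s) && (#|C| <= q).
Proof. by rewrite mem_filter mem_sort mem_enum andbC. Qed.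

Lemma has_short_cycleE q n (s : 'S_n) :
  has_short_cycle q s = (short_cycles q s != [::]).
Proof.
apply/exists_inP/idP => [[C sC Cq]|].
  have : C \in short_cycles q s by rewrite mem_short_cycles sC.
  by apply: contraTneq => ->.
case E: (short_cycles q s) => [|C r] // _.
by exists C; have := mem_short_cycles q s C; rewrite E mem_head => /esym/andP[].
Qed.

Lemma first_short_cycle_min q n (s : 'S_n) C : C \in short_cycles q s ->
  smallest_elt (head set0 (short_cycles q s)) <= smallest_elt C.
Proof.
pose le (A B : {set 'I_n}) := smallest_elt A <= smallest_elt B.
have le_tr : transitive le by move=> ? ? ?; apply: leq_trans.
have : sorted le (short_cycles q s).
  by apply: sorted_filter => //; apply: sort_sorted => A B; apply: leq_total.
case: (short_cycles q s) => //= D r; rewrite (path_sortedE le_tr) inE.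
by case/andP=> /allP leD _ /predU1P[->|/leD].
Qed.

(** Elements below the minimum of the first short cycle lie in long cycles, as
    a short cycle through such an element would come earlier.  Conversely, if
    [i] is fixed and everything below it is in long cycles, the minimum of the
    first short cycle is at most [i], hence equal to [i]. *)
Lemma fixed_point_firstE q n (s : 'S_n) : 0 < q ->
  has_short_cycle q s && (first_short_length q s == 1) =
  fixed_point_first q setT s.
Proof.
move=> q0; rewrite has_short_cycleE /first_short_length.
set C0 := head _ _.
have C0in : short_cycles q s != [::] -> C0 \in short_cycles q s.
  by rewrite /C0; case: (short_cycles q s) => //= *; rewrite mem_head.
have orb_in j : (porbit s j \in short_cycles q s) = (#|porbit s j| <= q).
  by rewrite mem_short_cycles imset_f.
have orbE C j : C \in short_cycles q s -> j \in C -> C = porbit s j.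
  rewrite mem_short_cycles => /andP[/imsetP[i _ ->] _].
  by rewrite -eq_porbit_mem => /eqP ->.
apply/andP/exists_inP => [[/C0in C0s C01]|[i _ /andP[si /forall_inP long]]].
  have [i defC0] := cards1P C01.
  have iE := orbE _ i C0s; rewrite defC0 set11 in iE.
  exists i; rewrite ?inE // -card_porbit_eq1 -iE // cards1 eqxx /=.
  apply/forall_inP => j /andP[_ ji]; rewrite ltnNge -orb_in.
  apply: contraL ji => /first_short_cycle_min; rewrite -/C0 -leqNgt => C0j.
  have [|i' + ij] := @smallest_elt_leP n C0 j.
    by apply: leq_trans C0j _; rewrite smallest_elt_le ?porbit_id.
  by rewrite defC0 => /set1P <-.
have is_i : porbit s i \in short_cycles q s.
  by rewrite orb_in (eqP (_ : #|_| == 1)) ?card_porbit_eq1.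
have ne : short_cycles q s != [::] by apply: contraTneq is_i => ->.
split=> //; have [|j jC0 ji] := @smallest_elt_leP n C0 i.
  apply: leq_trans (first_short_cycle_min is_i) _.
  by rewrite smallest_elt_le ?porbit_id.
have C0j : C0 = porbit s j by apply: orbE => //; apply: C0in.
have -> : C0 = porbit s i.
  rewrite C0j; congr porbit; apply/val_inj/eqP; rewrite eqn_leq ji leqNgt.
  apply/negP => lt_ji; have := long j; rewrite inE lt_ji => /(_ isT).
  by rewrite ltnNge -orb_in -C0j C0in.
by rewrite card_porbit_eq1.
Qed.

(** * The law of the outcome *)

Theorem theorem1 (n q : nat) (hn : 0 < n) (hq : 0 < q) :
  win_prob q n RandomPlayer
  = unif_prob (fun s : 'S_n =>
      has_short_cycle q s && (first_short_length q s == 1))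
  /\
  win_prob q n DeterministicPlayer
  = unif_prob (fun s : 'S_n =>
      (has_short_cycle q s && (2 <= first_short_length q s <= q))
      || ~~ has_short_cycle q s).
Proof.
have cSn : #|'S_n| = n`!.
  transitivity #|perm_on [set: 'I_n]|; last by rewrite card_perm cardsT card_ord.
  by apply: eq_card => s; apply/esym/subsetP => i; rewrite inE.
have Sn0 : (#|'S_n|%:R != 0 :> rat)%R by rewrite cSn pnatr_eq0 -lt0n fact_gt0.
have random : win_prob q n RandomPlayer = unif_prob (fun s : 'S_n =>
    has_short_cycle q s && (first_short_length q s == 1)).
  rewrite -[LHS]/(random_win_within q n n n).
  have := @random_win_within_eq q n n setT hq; rewrite cardsT card_ord => -> //.
  rewrite /fixed_point_first_prob /unif_prob cardsT card_ord cSn.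
  congr (_%:R / _)%R; apply: eq_card => s; rewrite !inE fixed_point_firstE //.
  by rewrite (_ : perm_on _ _) //; apply/subsetP => i; rewrite inE.
(* The two winning probabilities sum to [1], and the two events partition the
   permutations because the length of a first short cycle lies in [1 .. q]. *)
split=> //; have /eqP := win_prob_total q hn; rewrite addrC eq_sym -subr_eq.
move/eqP=> <-; rewrite random /unif_prob -[X in (X - _)%R](divff Sn0) -mulrBl.
congr (_ / _)%R; apply/eqP; rewrite subr_eq -natrD eqr_nat; apply/eqP.
rewrite addnC; set A := [set s | _]; rewrite -(cardC A); congr (_ + _).
apply: eq_card => s; rewrite !inE has_short_cycleE /first_short_length.
have := mem_short_cycles q s; case: (short_cycles q s) => //= C r /(_ C).
rewrite mem_head => /esym/andP[/imsetP[i _ ->] ->].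
by have := card_porbit_neq0 s i; case: #|_| => [|[|]].
Qed.
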